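(* In the setting described in the context, there exists a small absolute constant $c>0$ such that for every small enough absolute constant $\varepsilon>0$, every large enough $n$ (possibly depending on $\varepsilon$), every $G_X$ (with lengths $\ell$) in the support of $\mathrm{Ext}(G,H)$, and every integral solution $f:V\to T$ for $\mathcal{I}(G_X,\ell,L)$ of value at most $c\varepsilon^2n^2\log^{2/3}n$, there exists a map $\bar f:V_{G'}\to X$ (for some subgraph $G'$ of $G$) which is an $(\varepsilon\log^{4/3}n,\varepsilon)$-split.
   Context: Fix an integer $d\ge 3$. Let $G=(V_G,E_G)$ and $H=(V_H,E_H)$ be graphs with $n$ vertices each, both expanders that are Cayley graphs of groups with respect to $d$ generators (so of constant bounded degree $d$), and let $G$ have girth $\Omega(\log n)$. Here $\log$ is the natural logarithm. Give every edge of $G$ length $\log^{2/3}n$ and every edge of $H$ length $\log^{1/3}n$. The randomized extension $\mathrm{Ext}(G,H)$ is the random graph $G_X$ on vertex set $X=V_G\times V_H$ with the following edges: for each $g\in V_G$, $((g,h_1),(g,h_2))$ is an edge iff $(h_1,h_2)\in E_H$ (intra-cloud edge, length $\log^{1/3}n$); and for each $(g_1,g_2)\in E_G$, independently, a uniformly random perfect matching between $\{g_1\}\times V_H$ and $\{g_2\}\times V_H$ is added (inter-cloud edges, length $\log^{2/3}n$). The set $\{g\}\times V_H$ is called the cloud $g$. Denote the length function by $\ell$, by $D_X$ the shortest-path metric of $G_X$ w.r.t. $\ell$, and by $\pi:X\to V_G$ the projection $\pi((g,h))=g$. The instance $\mathcal{I}(G_X,\ell,L)$ with $L=\log n$ of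 $0$-Extension is: vertex set $V=X\cup T$ where $T=\{v_T:v\in X\}$ is a disjoint copy of $X$ and is the terminal set; edges: each $(u,v)\in E_X$ with weight $1/\ell(u,v)$, and each $(v,v_T)$, $v\in X$, with weight $1/L$; terminal metric $D(u_T,v_T)=D_X(u,v)+2L$ for $u\ne v$ and $0$ for $u=v$. An integral solution is $f:V\to T$ with $f(t)=t$ for all $t\in T$, of value $\sum_{(u,v)\in E}w_{(u,v)}D(f(u),f(v))$. Cycle-homeomorphism: for a subgraph $G'=(V_{G'},E_{G'})$ of $G$, a map $\tilde f:V_{G'}\to V_G$ and an assignment $P_{\tilde f}$ giving to each $(u,v)\in E_{G'}$ a path (walk) in $G$ from $\tilde f(u)$ to $\tilde f(v)$, the pair $(\tilde f,P_{\tilde f})$ is a cycle-homeomorphism of $G$ w.r.t. $G'$ if for every simple cycle $C\subseteq E_{G'}$, the set of edges of $G$ appearing an odd number of times (with multiplicity) in the paths $P_{\tilde f}(e')$, $e'\in C$, equals $C$. Split: a map $\bar f:V_{G'}\to X$ is an $(\alpha,\varepsilon)$-split if $G'=(V_{G'},E_{G'})$ is a subgraph of $G$ with $|E_{G'}|\ge(1-\varepsilon)|E_G|$ such that: (1) letting, for $(g_1,g_2)\in E_{G'}$, $P_{\pi\circ\bar f}((g_1,g_2))$ be the image under $\pi$ (collapsing intra-cloud edges) of the shortest path w.r.t. $\ell$ in the whole graph $G_X$ between $\bar f(g_1)$ and $\bar f(g_2)$, the pair $(\pi\circ\bar f,P_{\pi\circ\bar f})$ is a cycle-homeomorphism of $G$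 w.r.t. $G'$; (2) $D_X(\bar f(g_1),\bar f(g_2))<\alpha$ for every $(g_1,g_2)\in E_{G'}$; (3) for every $g\in V_{G'}$, the shortest path in $G$ between $g$ and $\pi\circ\bar f(g)$ has at most $\varepsilon\log n$ edges. *)

(* Defs.v *)
From mathcomp Require Import all_boot all_order all_algebra all_fingroup.
From mathcomp Require Import classical_sets reals exp.

Set Implicit Arguments.
Unset Strict Implicit.
Unset Printing Implicit Defensive.

Import Order.TTheory GRing.Theory Num.Theory.
Local Open Scope ring_scope.

Record sgraph (V : finType) := SGraph {
  adj :> rel V;
  adj_sym : symmetric adj;
  adj_irr : irreflexive adj }.

Definition edge_set (V : finType) (G : sgraph V) : {set {set V}} :=
  [set [set p.1; p.2] | p : V * V & G p.1 p.2].

Definition subgraph (V : finType) (G : sgraph V)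
    (V' : {set V}) (E' : {set {set V}}) : Prop :=
  E' \subset edge_set G /\ (forall e, e \in E' -> e \subset V').

(* A walk is the nonempty sequence of its vertices. *)
Definition is_walk (V : finType) (e : rel V) (w : seq V) (x y : V) : bool :=
  if w is z :: p then [&& z == x, path e z p & last z p == y] else false.

Definition steps (V : finType) (w : seq V) : seq (V * V) := zip w (behead w).

Definition walk_edges (V : finType) (w : seq V) : seq {set V} :=
  [seq [set p.1; p.2] | p <- steps w].

Definition wlen (R : realType) (V : finType) (len : V -> V -> R) (w : seq V) : R :=
  \sum_(p <- steps w) len p.1 p.2.

(* Only meaningful between connected vertices: [inf] of the empty set is 0. *)
Definition spdist (R : realType) (V : finType) (e : rel V) (len : V -> V -> R)
    (x y : V) : R :=
  inf [set wlen len w | w in [set w | is_walk e w x y]]%classic.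

Definition shortest_path (R : realType) (V : finType) (e : rel V)
    (len : V -> V -> R) (w : seq V) (x y : V) : Prop :=
  is_walk e w x y /\ wlen len w = spdist e len x y.

(* Each undirected edge occurs twice, once per orientation, in the double sum. *)
Definition edge_sum (R : realType) (V : finType) (e : rel V) (F : V -> V -> R) : R :=
  (\sum_u \sum_(v | e u v) F u v) / 2.

Definition cayley (d : nat) (V : finType) (G : sgraph V) : Prop :=
  exists (gT : finGroupType) (S : {set gT}) (phi : V -> gT),
    [/\ bijective phi,
        #|S| = d,
        (forall s, s \in S -> s^-1%g \in S),
        <<S>>%g = [set: gT]
      & forall x y, G x y = (((phi x)^-1 * phi y)%g \in S)].

Definition expander (R : realType) (phi : R) (V : finType) (G : sgraph V) : Prop :=
  forall A : {set V}, (2 * #|A| <= #|V|)%N ->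
    phi * #|A|%:R
      <= #|[set p : V * V | [&& p.1 \in A, p.2 \notin A & G p.1 p.2]]|%:R.

Definition girth_ge (R : realType) (k : R) (V : finType) (G : sgraph V) : Prop :=
  forall s : seq V, ucycleb G s -> (2 < size s)%N -> k <= (size s)%:R.

(* [sg (g1, g2)] is the perfect matching between the clouds g1 and g2, as a
   bijection from cloud g1 to cloud g2; the matching of an undirected edge must
   not depend on its orientation.  Under the uniform law on these families the
   matchings of distinct edges of G are independent and uniform. *)
Definition matchings (VG VH : finType) : {set {ffun VG * VG -> {perm VH}}} :=
  [set sg : {ffun VG * VG -> {perm VH}} |
     [forall g1, forall g2, forall h, sg (g2, g1) (sg (g1, g2) h) == h]].

Definition ext_rel (VG VH : finType) (G : sgraph VG) (H : sgraph VH)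
    (sg : {ffun VG * VG -> {perm VH}}) : rel (VG * VH) :=
  fun u v => ((u.1 == v.1) && H u.2 v.2)
          || (G u.1 v.1 && (sg (u.1, v.1) u.2 == v.2)).

Definition Ext_prob (VG VH : finType) (G : sgraph VG) (H : sgraph VH)
    (GX : sgraph (VG * VH)%type) : rat :=
  #|[set sg in matchings VG VH |
      [forall u, forall v, ext_rel G H sg u v == GX u v]]|%:R
  / #|matchings VG VH|%:R.

Definition Ext_support (VG VH : finType) (G : sgraph VG) (H : sgraph VH)
    (GX : sgraph (VG * VH)%type) : Prop :=
  0 < Ext_prob G H GX.

Definition logR (R : realType) (n : nat) : R := ln n%:R.

Definition ell (R : realType) (n : nat) (VG VH : finType) (u v : VG * VH) : R :=
  if u.1 == v.1 then logR R n `^ (1 / 3) else logR R n `^ (2 / 3).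

(* The vertex set is the sum type X + X, with [inr v] the terminal v_T.
   Functions with values in, or arguments from, the terminal set are typed
   with X, v standing for v_T. *)
Definition inst_rel (X : finType) (GX : sgraph X) : rel (X + X) :=
  fun a b => match a, b with
  | inl u, inl v => GX u v
  | inl u, inr v | inr v, inl u => u == v
  | inr _, inr _ => false
  end.

Definition inst_weight (R : realType) (X : finType) (len : X -> X -> R) (L : R)
    (a b : X + X) : R :=
  match a, b with
  | inl u, inl v => 1 / len u v
  | _, _ => 1 / L
  end.

Definition inst_metric (R : realType) (X : finType) (GX : sgraph X)
    (len : X -> X -> R) (L : R) (u v : X) : R :=
  if u == v then 0 else spdist GX len u v + 2 * L.

Definition integral_solution (X : finType) (f : X + X -> X) : Prop :=
  forall t : X, f (inr t) = t.

Definition inst_value (R : realType) (X : finType) (GX : sgraph X)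
    (len : X -> X -> R) (L : R) (f : X + X -> X) : R :=
  edge_sum (inst_rel GX)
    (fun a b => inst_weight len L a b * inst_metric GX len L (f a) (f b)).

Definition cycle_edges (V : finType) (s : seq V) : {set {set V}} :=
  [set [set x; next s x] | x in s].

Definition simple_cycle_in (V : finType) (E' : {set {set V}}) (s : seq V) : Prop :=
  ucycleb (fun x y => [set x; y] \in E') s /\ (2 < size s)%N.

(* Maps defined on V_{G'} are represented by total functions on V, whose values
   outside V_{G'} are never used.  The walk of an undirected edge may be listed
   in either direction. *)
Definition cycle_homeomorphism (V : finType) (G : sgraph V) (E' : {set {set V}})
    (f : V -> V) (P : {set V} -> seq V) : Prop :=
  (forall u v, [set u; v] \in E' ->
     is_walk G (P [set u; v]) (f u) (f v) \/ is_walk G (P [set u; v]) (f v) (f u))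
  /\ (forall s, simple_cycle_in E' s ->
        [set e in edge_set G |
          odd (\sum_(e' in cycle_edges s) count_mem e (walk_edges (P e')))]
        = cycle_edges s).

Fixpoint drop_repeats (V : eqType) (x : V) (p : seq V) : seq V :=
  if p is y :: p' then
    if x == y then drop_repeats x p' else y :: drop_repeats y p'
  else [::].

(* G has no loops, so the intra-cloud edges of a walk in G_X are exactly the
   steps that repeat the first coordinate. *)
Definition project_walk (VG VH : finType) (w : seq (VG * VH)) : seq VG :=
  if w is u :: p then u.1 :: drop_repeats u.1 [seq v.1 | v <- p] else [::].

(* The first property is required for every way of breaking ties between
   shortest paths. *)
Definition is_split (R : realType) (n : nat) (VG VH : finType) (G : sgraph VG)
    (GX : sgraph (VG * VH)%type) (len : VG * VH -> VG * VH -> R) (alpha eps : R)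
    (V' : {set VG}) (E' : {set {set VG}}) (fbar : VG -> VG * VH) : Prop :=
  [/\ subgraph G V' E' /\ (1 - eps) * #|edge_set G|%:R <= #|E'|%:R,
      (forall P : {set VG} -> seq (VG * VH),
         (forall u v, [set u; v] \in E' ->
            shortest_path GX len (P [set u; v]) (fbar u) (fbar v) \/
            shortest_path GX len (P [set u; v]) (fbar v) (fbar u)) ->
         cycle_homeomorphism G E' (fun g => (fbar g).1)
           (fun e => project_walk (P e))),
      (forall u v, [set u; v] \in E' ->
         spdist GX len (fbar u) (fbar v) < alpha)
    & (forall g, g \in V' ->
         spdist G (fun _ _ => 1 : R) g (fbar g).1 <= eps * logR R n)].

(* Main.v *)
(* A solution of small value cuts few edges inside most clouds, so by expansion
   of H it is constant, equal to some [fbar g], on more than three quarters of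
   almost every cloud g.  More than half of the matching between two such clouds
   then joins points sent to [fbar g1] and [fbar g2]; by Markov's inequality these
   are close for most edges of G, and likewise g is close to the projection of
   [fbar g] for most g.

   The homeomorphism property comes from the girth.  For a kept edge uv, the walk
   u -> fbar u -> fbar v -> v -> u projects to a closed walk of G shorter than the
   girth, hence uses every edge an even number of times. *)

Require Import Defs.
From mathcomp Require Import all_boot all_order all_algebra all_fingroup.
From mathcomp Require Import classical_sets reals exp.
From mathcomp Require Import zify lra ring.

Set Implicit Arguments.
Unset Strict Implicit.
Unset Printing Implicit Defensive.

Import Order.TTheory GRing.Theory Num.Theory.
Local Open Scope ring_scope.

(** * Parity of edges in closed walks below the girth *)

Lemma walk_edges_cat (V : finType) (x : V) p q :
  walk_edges (x :: p ++ q) = walk_edges (x :: p) ++ walk_edges (last x p :: q).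
Proof.
elim: p x => [|y p IHp] x //=.
by rewrite -[LHS]/([set x; y] :: walk_edges (y :: p ++ q)) IHp.
Qed.

Lemma not_uniq_split (T : eqType) (s : seq T) :
  ~~ uniq s -> exists y s1 s2 s3, s = s1 ++ y :: s2 ++ y :: s3.
Proof.
elim: s => [|x s IHs] //=; rewrite negb_and negbK.
have [|_ /= /IHs [y [s1 [s2 [s3 ->]]]]] := boolP (x \in s).
  by case/splitPr => s2 s3 _; exists x, [::], s2, s3.
by exists y, (x :: s1), s2, s3.
Qed.

(* A closed walk that repeats a vertex splits there into two shorter ones, and
   a closed walk that repeats none is a simple cycle or backtracks. *)
Lemma closed_walk_even (R : realType) (V : finType) (G : sgraph V) (k : R)
    (x : V) (p : seq V) (e : {set V}) :
  girth_ge k G -> path G x p -> last x p = x -> (size p)%:R < k ->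
  ~~ odd (count_mem e (walk_edges (x :: p))).
Proof.
move=> girthG; have [m] := ubnP (size p); elim: m x p => // m IHm x p /ltnSE le_pm.
move=> Gp px lt_pk; have [Up | /not_uniq_split] := boolP (uniq p).
  (* Fewer than three steps form no cycle: one step would be a loop, and two steps run along one
     edge and back. *)
  case: p => [|y [|z [|t p]]] // in le_pm Gp px lt_pk Up *.
  - by move: Gp; rewrite /= -[in G x y]px /= adj_irr.
  - by rewrite /walk_edges /= -[z]/(last x [:: y; z]) px /= finset.setUC addn0 addnn odd_double.
  (* Since [x] is the last vertex of [p], the sequence [p] alone lists the cycle. *)
  suff /girthG/(_ isT): ucycleb G [:: y, z, t & p] by rewrite leNgt lt_pk.
  have /andP[Gxy Gyp] : G x y && path G y [:: z, t & p] := Gp.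
  rewrite /ucycleb Up andbT.
  rewrite -[path.cycle _ _]/(path G y (rcons [:: z, t & p] y)) rcons_path Gyp.
  by rewrite -[last _ _]/(last x [:: y, z, t & p]) px Gxy.
case=> y [p1 [p2 [p3 def_p]]].
rewrite {}def_p in le_pm Gp px lt_pk *.
move: Gp; rewrite -cat_rcons cat_path last_rcons => /andP[Gp1].
rewrite -cat_rcons cat_path last_rcons => /andP[Gp2 Gp3].
have sz : size (p1 ++ y :: p2 ++ y :: p3) = (size (rcons p1 y ++ p3) + size (rcons p2 y))%N.
  by rewrite !(size_cat, size_rcons) /= size_cat /=; ring.
have sz1 : (size (rcons p1 y ++ p3) < size (p1 ++ y :: p2 ++ y :: p3))%N.
  by rewrite sz size_rcons addnS ltnS leq_addr.
have sz2 : (size (rcons p2 y) < size (p1 ++ y :: p2 ++ y :: p3))%N.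
  by rewrite sz size_cat [size (rcons p1 y)]size_rcons !addSn ltnS leq_addl.
have ltk q : (size q < size (p1 ++ y :: p2 ++ y :: p3))%N -> (size q)%:R < k.
  by move=> /ltnW le_q; apply: le_lt_trans lt_pk; rewrite ler_nat.
have e1 : ~~ odd (count_mem e (walk_edges (x :: rcons p1 y ++ p3))).
  apply: IHm; rewrite ?(leq_trans sz1) ?cat_path ?last_rcons ?Gp1 //; last exact: ltk.
  by rewrite -[RHS]px !last_cat /= last_cat last_rcons.
have e2 : ~~ odd (count_mem e (walk_edges (y :: rcons p2 y))).
  by apply: IHm; rewrite ?(leq_trans sz2) ?last_rcons //; exact: ltk.
move: e1; rewrite !walk_edges_cat !last_rcons !count_cat !oddD.
by rewrite (negbTE e2).
Qed.

(** Lets a closed walk return along [q v] traversed backwards while keeping its edge counts. *)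
Lemma walk_rev (V : finType) (G : sgraph V) (x : V) (p : seq V) :
  path G x p ->
  exists q, [/\ path G (last x p) q, last (last x p) q = x, size q = size p
    & forall e, count_mem e (walk_edges (last x p :: q))
              = count_mem e (walk_edges (x :: p))].
Proof.
elim: p x => [|y p IHp] x; first by exists [::].
move=> /andP[Gxy /IHp[q [Gq qy sz cnt]]]; exists (rcons q x) => /=.
rewrite rcons_path Gq qy adj_sym Gxy last_rcons size_rcons sz; split=> // e.
rewrite -cats1 walk_edges_cat count_cat cnt qy /walk_edges /= addn0 addnC.
by rewrite [[set y; x]]finset.setUC.
Qed.

Lemma next_next_neq (T : eqType) (s : seq T) x :
  uniq s -> (2 < size s)%N -> x \in s -> next s (next s x) != x.
Proof.
move=> Us sz_s s_x; have [i s' def_s] := rot_to s_x.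
rewrite -!(next_rot i Us) def_s.
have: uniq (x :: s') by rewrite -def_s rot_uniq.
have: (2 < size (x :: s'))%N by rewrite -def_s size_rot.
case: s' {def_s} => [|y [|z s']] //= _; rewrite !inE !negb_or eqxx.
case/andP=> /and3P[xy xz _] _.
by rewrite [y == x]eq_sym (negbTE xy) eqxx eq_sym.
Qed.

(** Two distinct vertices giving the same edge would be successors of each other, which needs a
    cycle of length two. Sums over the edges of a cycle thus become sums over its vertices. *)
Lemma cycle_edge_inj (V : finType) (s : seq V) :
  uniq s -> (2 < size s)%N -> {in s &, injective (fun x => [set x; next s x])}.
Proof.
move=> Us sz_s x y s_x s_y /= exy.
have: x \in [set y; next s y] by rewrite -exy !inE eqxx.
have: y \in [set x; next s x] by rewrite exy !inE eqxx.
rewrite !inE => /orP[/eqP// | /eqP y_nx] /orP[/eqP// | /eqP x_ny].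
by have /eqP[] := next_next_neq Us sz_s s_x; rewrite -y_nx.
Qed.

Lemma edge_setE (V : finType) (G : sgraph V) u v : ([set u; v] \in edge_set G) = G u v.
Proof.
apply/imsetP/idP => [[[a b]] /= | Guv]; last by exists (u, v); rewrite ?inE.
rewrite inE /= => Gab /setP e; have irr := adj_irr G.
move: (e a) (e b) (e u) (e v); rewrite !inE !eqxx !orbT /=.
case/orP=> /eqP a_; case/orP=> /eqP b_; move: Gab; rewrite a_ b_ ?irr //.
by rewrite adj_sym.
Qed.

(** * Cycle-homeomorphisms from short walks *)

Section CycleHomeomorphism.

Variables (R : realType) (V : finType) (G : sgraph V) (k : R).
Variables (E' : {set {set V}}) (f : V -> V) (P : {set V} -> seq V).
Variable q : V -> seq V.

Hypothesis girthG : girth_ge k G.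
Hypothesis E'G : E' \subset edge_set G.
Hypothesis walkP : forall u v, [set u; v] \in E' ->
  is_walk G (P [set u; v]) (f u) (f v) \/ is_walk G (P [set u; v]) (f v) (f u).
Hypothesis walkq : forall u v, [set u; v] \in E' ->
  path G u (q u) /\ last u (q u) = f u.
Hypothesis short : forall u v, [set u; v] \in E' ->
  (size (q u) + size (P [set u; v]) + size (q v))%:R < k.

(** Cross from [v] to [u], follow [q u], then [P], then [q v] backwards: this closed walk is below
    the girth bound, so it uses every edge evenly often. *)
Lemma walk_parity u v e : [set u; v] \in E' ->
  odd (count_mem e (walk_edges (P [set u; v])))
  = odd (count_mem e (walk_edges (u :: q u)) + count_mem e (walk_edges (v :: q v))
         + (e == [set u; v])).
Proof.
(* The parity claim is symmetric in [u] and [v], so the direction in which [P] lists its walk may be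
   fixed. *)
wlog: u v / is_walk G (P [set u; v]) (f u) (f v) => [IH E'uv|].
  have [/IH-> // | w] := walkP E'uv.
  by rewrite finset.setUC [X in odd (X + _)]addnC IH // finset.setUC.
case def_P: (P _) => [|z p] //= /and3P[/eqP-> Gp /eqP lp] E'uv.
have E'vu : [set v; u] \in E' by rewrite finset.setUC.
have Gvu : G v u by rewrite -edge_setE (fintype.subsetP E'G).
have [Gqu lqu] := walkq E'uv; have [Gqv lqv] := walkq E'vu.
have [q' [Gq' lq' sq' cq']] := walk_rev Gqv; rewrite lqv in Gq' lq' cq'.
have /(_ e) := closed_walk_even (x := v) (p := u :: q u ++ p ++ q') _ girthG.
rewrite /= !cat_path !last_cat lqu lp Gvu Gqu Gp Gq' lq' !size_cat sq'.
(* [P] is measured in vertices, one more than its steps; the extra one accounts for the closing step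
   from [v] to [u]. *)
have := short E'uv; rewrite def_P /= addnS addSn -addnA => -> /(_ isT erefl isT).
rewrite -[map _ _]/(walk_edges (u :: q u ++ p ++ q')).
rewrite !walk_edges_cat lqu lp !count_cat cq' [[set v; u]]finset.setUC [_ == e]eq_sym.
by rewrite !oddD; do 4!case: (odd _).
Qed.

(* Modulo 2, the walk of an edge uv is uv plus the walks [q u] and [q v], and
   around a cycle every [q u] cancels. *)
Lemma cycle_homeomorphism_of_short_walks : cycle_homeomorphism G E' f P.
Proof.
split=> // s [/andP[E's Us] sz_s].
have inj := cycle_edge_inj Us sz_s.
have E'next x : x \in s -> [set x; next s x] \in E' by apply: next_cycle E's.
have cE' e : e \in cycle_edges s -> e \in E'.
  by case/imsetP=> x s_x ->; apply: E'next.
apply/setP=> e; rewrite inE.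
suff -> : odd (\sum_(e' in cycle_edges s) count_mem e (walk_edges (P e')))
          = (e \in cycle_edges s).
  by apply/andP/idP => [[] // | ce]; split; rewrite // (fintype.subsetP E'G) ?cE'.
pose B x := count_mem e (walk_edges (x :: q x)).
(* [next s] permutes the vertices of the cycle. *)
have sumB : (\sum_(x in s) B (next s x) = \sum_(x in s) B x)%N.
  rewrite [RHS](reindex_inj (can_inj (prev_next Us))).
  by apply: eq_bigl => x; rewrite mem_next.
(* By injectivity at most one vertex of the cycle yields the edge [e]. *)
have sumI : (\sum_(x in s) (e == [set x; next s x]) = (e \in cycle_edges s))%N.
  rewrite -(big_imset (fun e' => nat_of_bool (e == e')) inj) -/(cycle_edges s).
  have [ce | ce] := boolP (e \in _).
    by rewrite (bigD1 e) //= eqxx big1 // => e' /andP[_]; rewrite eq_sym => /negbTE->.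
  by rewrite big1 // => e' ce'; case: eqP => // ee'; rewrite ee' ce' in ce.
rewrite (big_imset _ inj) /=.
have -> : odd (\sum_(x in s) count_mem e (walk_edges (P [set x; next s x])))
  = odd (\sum_(x in s) (B x + B (next s x) + (e == [set x; next s x]))).
  rewrite !(big_morph odd oddD (erefl : odd 0 = false)).
  by apply: eq_bigr => x s_x; rewrite walk_parity ?E'next.
by rewrite !big_split /= sumB sumI addnn oddD odd_double; case: (_ \in _).
Qed.

End CycleHomeomorphism.

(** * Walk lengths and shortest-path distances *)

Lemma wlen_cons (R : realType) (V : finType) (len : V -> V -> R) x y p :
  wlen len [:: x, y & p] = len x y + wlen len (y :: p).
Proof. by rewrite /wlen big_cons. Qed.

Lemma wlen1 (R : realType) (V : finType) (x : V) p :
  wlen (fun _ _ => 1 : R) (x :: p) = (size p)%:R.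
Proof.
elim: p x => [|y p IHp] x; first by rewrite /wlen big_nil.
by rewrite wlen_cons IHp /= -natr1 addrC.
Qed.

Section ShortestPaths.

Variables (R : realType) (V : finType) (e : rel V) (len : V -> V -> R).
Hypothesis len_ge0 : forall x y, 0 <= len x y.

Lemma wlen_ge0 w : 0 <= wlen len w.
Proof. by apply: sumr_ge0 => p _; apply: len_ge0. Qed.

Lemma spdist_ge0 x y : 0 <= spdist e len x y.
Proof.
rewrite /spdist; set S := (X in inf X).
have [-> | /set0P[r Sr]] := eqVneq S classical_sets.set0; first by rewrite inf0.
by apply: lb_le_inf; [exists r | move=> _ [w _ <-]; apply: wlen_ge0].
Qed.

Lemma spdist_le_wlen x y w : is_walk e w x y -> spdist e len x y <= wlen len w.
Proof.
move=> ew; apply: ge_inf; last by exists w.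
by exists 0 => _ [w' _ <-]; apply: wlen_ge0.
Qed.

Lemma spdist_xx_le0 x : spdist e len x x <= 0.
Proof.
apply: le_trans (@spdist_le_wlen x x [:: x] _) _; first by rewrite /= eqxx.
by rewrite /wlen big_nil.
Qed.

Lemma connect_walk x y : connect e x y -> exists w, is_walk e w x y.
Proof. by case/connectP=> p ep ->; exists (x :: p); rewrite /= eqxx ep eqxx. Qed.

(** Connectedness rules out the default value 0 of an empty infimum. The strict bound yields a walk
    without any claim that the infimum is attained. *)
Lemma spdist_lt_walk x y b : connect e x y -> spdist e len x y < b ->
  exists2 w, is_walk e w x y & wlen len w < b.
Proof.
case/connect_walk=> w0 ew0 /inf_lt[].
  by exists (wlen len w0); exists w0.
by move=> _ [w ew <-] ltb; exists w.
Qed.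

Lemma le_spdist x y b : connect e x y ->
  (forall w, is_walk e w x y -> b <= wlen len w) -> b <= spdist e len x y.
Proof.
case/connect_walk=> w0 ew0 leb; apply: lb_le_inf.
  by exists (wlen len w0); exists w0.
by move=> _ [w ew <-]; apply: leb.
Qed.

End ShortestPaths.

(** * Connectivity and projection of the extension *)

(** No edge leaves a connected component, nor its complement. Whichever of the two has at most half
    of the vertices is empty by expansion, and the component contains [x]. *)
Lemma expander_connect (R : realType) (phi : R) (V : finType) (G : sgraph V) x y :
  0 < phi -> expander phi G -> connect G x y.
Proof.
move=> phi_gt0 expG.
have closed_empty (A : {set V}) : (2 * #|A| <= #|V|)%N ->
    (forall a b, a \in A -> G a b -> b \in A) -> A = finset.set0.
  move=> /expG leA clA; apply/eqP; rewrite -cards_eq0 -leqn0 -(ler_nat R).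
  rewrite -(ler_pM2l phi_gt0) mulr0; apply: le_trans leA _.
  rewrite lern0 cards_eq0 -finset.subset0; apply/fintype.subsetP => p.
  by rewrite !inE => /and3P[Aa Ab /(clA _ _ Aa)]; rewrite (negPf Ab).
pose A := [set z | connect G x z].
have clA a b : a \in A -> G a b -> b \in A.
  by rewrite !inE => xa Gab; apply: connect_trans xa (connect1 Gab).
have [/closed_empty/(_ clA) A0 | gtA] := leqP (2 * #|A|) #|V|.
  by have := finset.in_set0 x; rewrite -A0 inE connect0.
have : ~: A = finset.set0.
  apply: closed_empty => [|a b]; first by have := cardsC A; lia.
  by rewrite !inE adj_sym => nxa Gba; apply: contraNN nxa => xb; apply: connect_trans xb (connect1 Gba).
by move/setP/(_ y); rewrite !inE => /negbFE.
Qed.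

(** Positive probability means a nonempty set of families; from here on the graph is handled through
    one fixed [sg]. *)
Lemma Ext_supportP (VG VH : finType) (G : sgraph VG) (H : sgraph VH)
    (GX : sgraph (VG * VH)%type) :
  Ext_support G H GX -> exists sg, forall u v, GX u v = ext_rel G H sg u v.
Proof.
rewrite /Ext_support /Ext_prob => supp.
have [S0 | [sg]] := set_0Vmem [set sg in matchings VG VH |
      [forall u, forall v, ext_rel G H sg u v == GX u v]].
  by move: supp; rewrite S0 cards0 mul0r ltxx.
by rewrite inE => /andP[_ /'forall_'forall_eqP eqGX]; exists sg => u v.
Qed.

Section Extension.

Variables (VG VH : finType) (G : sgraph VG) (H : sgraph VH).
Variables (GX : sgraph (VG * VH)%type) (sg : {ffun VG * VG -> {perm VH}}).
Hypothesis GXE : forall u v, GX u v = ext_rel G H sg u v.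

Lemma intra_edge g h h' : GX (g, h) (g, h') = H h h'.
Proof. by rewrite GXE /ext_rel /= eqxx adj_irr orbF. Qed.

Lemma inter_edge g g' h : G g g' -> GX (g, h) (g', sg (g, g') h).
Proof. by rewrite GXE /ext_rel /= eqxx => ->; rewrite orbT. Qed.

Lemma edge_project u v : GX u v -> u.1 != v.1 -> G u.1 v.1.
Proof. by rewrite GXE => /orP[/andP[/eqP->]|/andP[]//]; rewrite eqxx. Qed.

(** Follow a path of [G] by one matching edge per step, then correct the second coordinate inside
    the last cloud. *)
Lemma extension_connect u v :
  (forall g g', connect G g g') -> (forall h h', connect H h h') ->
  connect GX u v.
Proof.
move=> conG conH.
have cloud g h h' : connect GX (g, h) (g, h').
  case/connectP: (conH h h') => p Hp ->; elim: p h Hp => [|h1 p IHp] h /=.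
    by rewrite connect0.
  by case/andP=> Hh /IHp; apply: connect_trans; rewrite connect1 ?intra_edge.
case: u v => g h [g' h']; case/connectP: (conG g g') => p Gp ->.
elim: p g h Gp => [|g1 p IHp] g h /=; first by move=> _; apply: cloud.
by case/andP=> /(inter_edge h)/connect1/connect_trans GXh /IHp/GXh.
Qed.

Variables (R : realType) (n : nat).
Local Notation len := (@ell R n VG VH).

Lemma ell_ge0 u v : 0 <= len u v.
Proof. by rewrite /ell; case: ifP => _; apply: powR_ge0. Qed.

Lemma project_walkP w u v : is_walk GX w u v ->
  is_walk G (project_walk w) u.1 v.1 /\
  logR R n `^ (2 / 3) * (size (project_walk w)).-1%:R <= wlen len w.
Proof.
case: w => // z p /= /and3P[/eqP-> GXp /eqP <-]; rewrite eqxx /= {z v}.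
elim: p u GXp => [|v p IHp] u /=.
  by rewrite eqxx mulr0 wlen_ge0 //; apply: ell_ge0.
rewrite wlen_cons => /andP[GXuv /IHp[/andP[Gp lp] le_p]].
case: (eqVneq u.1 v.1) => [-> | uv] /=.
  by rewrite Gp lp; split=> //; rewrite (le_trans le_p) // lerDr ell_ge0.
rewrite edge_project // Gp lp; split=> //.
by rewrite -[X in _ * X <= _]natr1 mulrDr mulr1 addrC lerD // /ell (negPf uv).
Qed.

Lemma spdist_project u v : connect GX u v ->
  logR R n `^ (2 / 3) * spdist G (fun _ _ => 1 : R) u.1 v.1 <= spdist GX len u v.
Proof.
move=> conGX; apply: le_spdist conGX _ => w /project_walkP[Gw].
apply: le_trans; apply: ler_wpM2l; first exact: powR_ge0.
apply: le_trans (spdist_le_wlen _ Gw) _; first by move=> *; apply: ler01.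
by case: (project_walk w) Gw => [|x p] //; rewrite wlen1.
Qed.

End Extension.

(** * Majority values on an expander *)

Section Majority.

Variables (R : realType) (phi : R) (V : finType) (G : sgraph V).
Variables (T : eqType) (F : V -> T).
Hypothesis phi_gt0 : 0 < phi.
Hypothesis expG : expander phi G.

(** If every level set of [F] has at most half of the vertices, expansion of all of them gives
    [phi * #|V|] cut pairs. Otherwise one level set exceeds half; its complement expands, so with
    fewer than [phi * #|V| / 4] cut pairs that complement has less than a quarter of the
    vertices. *)
Lemma expander_majority : (0 < #|V|)%N ->
  phi * #|V|%:R / 4 <= #|[set p : V * V | G p.1 p.2 && (F p.1 != F p.2)]|%:R
  \/ exists v0, (3 * #|V| < 4 * #|[set v | F v == F v0]|)%N.
Proof.
move=> V_gt0; set K := [set p | _].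
pose A v := [set w | F w == F v].
have [small | ] := boolP [forall v, 2 * #|A v| <= #|V|]%N; last first.
  case/forallPn => v; rewrite -ltnNge => bigA.
  have [leK | gtK] := lerP (phi * #|V|%:R / 4) #|K|%:R; [by left | right].
  exists v; rewrite -/(A v).
  have /expG leC : (2 * #|~: A v| <= #|V|)%N by have := cardsC (A v); lia.
  have {leC} leC : phi * #|~: A v|%:R <= #|K|%:R.
    apply: le_trans leC _; rewrite ler_nat; apply: subset_leq_card.
    apply/fintype.subsetP => -[a b]; rewrite !inE /= negbK.
    by case/and3P=> Fa /eqP-> ->; rewrite Fa.
  have: phi * (4 * #|~: A v|)%:R < phi * #|V|%:R by rewrite natrM; lra.
  by rewrite ltr_pM2l // ltr_nat; have := cardsC (A v); lia.
left.
pose img := [set A v | v in [set: V]].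
have partV : finset.partition img [set: V].
  have -> : img = equivalence_partition (fun v w => F w == F v) [set: V].
    by apply: eq_imset => v; apply/setP => w; rewrite !inE.
  apply: equivalence_partitionP => x y z _ _ _; split=> //.
  by move/eqP->.
have cardV := card_partition partV.
have le1 : phi * #|V|%:R <= \sum_(B in img) #|[set p in K | p.1 \in B]|%:R.
  rewrite -cardsT cardV natr_sum mulr_sumr; apply: ler_sum => _ /imsetP[v _ ->].
  apply: le_trans (expG (forallP small v)) _.
  rewrite ler_nat; apply: subset_leq_card; apply/fintype.subsetP => -[a b].
  rewrite !inE /= => /and3P[/eqP-> bv ->]; rewrite eqxx andbT eq_sym.
  exact: bv.
(* Each ordered cut pair is counted once, in the level set of its first endpoint. *)
have: \sum_(B in img) #|[set p in K | p.1 \in B]|%:R = #|K|%:R :> R.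
  rewrite -natr_sum; congr (_%:R).
  under eq_bigr => B _ do rewrite -sum1_card.
  rewrite -[RHS]sum1_card (partition_big (fun p => A p.1) (mem img)) /=; last first.
    by move=> p _; apply: imset_f; rewrite inE.
  apply: eq_bigr => _ /imsetP[v _ ->]; apply: eq_bigl => p; rewrite !inE.
  congr (_ && _); apply/eqP/eqP => [Fp | /setP/(_ p.1)]; last by rewrite !inE eqxx => /esym/eqP.
  by apply/setP => w; rewrite !inE Fp.
move=> sumK; have := mulr_ge0 (ltW phi_gt0) (ler0n R #|V|); move: le1; rewrite sumK; lra.
Qed.

End Majority.

(** * Counting edges, and Markov's inequality *)

Lemma card_edge_set (V : finType) (G : sgraph V) :
  (#|edge_set G| * 2 = #|[set p : V * V | G p.1 p.2]|)%N.
Proof.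
rewrite -[RHS]sum1_card (partition_big (fun p => [set p.1; p.2]) (mem (edge_set G))) /=.
  rewrite -sum_nat_const; apply: eq_bigr => _ /imsetP[[a b] /[!inE] /= Gab ->].
  have ab : a != b by apply: contraTneq Gab => ->; rewrite adj_irr.
  have -> : 2%N = #|[set (a, b); (b, a)]| by rewrite cards2 xpair_eqE (negPf ab).
  rewrite -sum1_card; apply: eq_bigl => -[u v]; rewrite !inE /=.
  apply/orP/andP => [[]/eqP[-> ->] | [Guv /eqP/setP e]].
  - by split.
  - by rewrite adj_sym finset.setUC.
  move: (e u) (e v) (e a) (e b); rewrite !inE !eqxx !orbT /=.
  move=> /esym/orP[]/eqP-> /esym/orP[]/eqP->; rewrite ?orbb ?eqxx; try by [left | right].
    by move=> _ /eqP ba; rewrite ba eqxx in ab.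
  by move=> /eqP ba; rewrite ba eqxx in ab.
by move=> [a b] /[!inE] /= Gab; rewrite edge_setE.
Qed.

(** The neighbours of [x] correspond to the connection set by left translation. *)
Lemma cayley_degree d (V : finType) (G : sgraph V) x :
  cayley d G -> #|[set y | G x y]| = d.
Proof.
case=> gT [S [psi [[psi' psiK psi'K] <- _ _ GE]]].
rewrite -(on_card_preimset (f := fun y => ((psi x)^-1 * psi y)%g)).
  by apply: eq_card => y; rewrite !inE GE.
apply: onW_bij; exists (fun s => psi' (psi x * s)%g) => y.
  by rewrite mulKVg psiK.
by rewrite psi'K mulKg.
Qed.

Lemma card_pairs_from (V : finType) (G : sgraph V) d (B : {set V}) :
  (forall x, #|[set y | G x y]| = d) ->
  #|[set p : V * V | G p.1 p.2 && (p.1 \in B)]| = (#|B| * d)%N.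
Proof.
move=> degG; rewrite -sum_nat_const -sum1_card.
transitivity (\sum_(x in B) \sum_(y | G x y) 1)%N.
  by rewrite pair_big_dep /=; apply: eq_bigl => p; rewrite !inE andbC.
by apply: eq_bigr => x _; rewrite sum1dep_card -(degG x).
Qed.

Lemma card_swap_pairs (V : finType) (Q : V -> V -> bool) :
  #|[set p : V * V | Q p.2 p.1]| = #|[set p : V * V | Q p.1 p.2]|.
Proof.
rewrite -(on_card_preimset (f := fun p : V * V => (p.2, p.1))).
  by apply: eq_card => p; rewrite !inE.
by apply: onW_bij; exists (fun p : V * V => (p.2, p.1)) => -[].
Qed.

Lemma markov_card (R : realType) (I : finType) (a : I -> R) (t : R) (S : {set I}) :
  (forall i, 0 <= a i) -> (forall i, i \in S -> t <= a i) ->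
  #|S|%:R * t <= \sum_i a i.
Proof.
move=> a_ge0 aS; rewrite mulr_natl -sumr_const.
rewrite [leRHS](bigID (mem S)) /= -[leLHS]addr0.
by rewrite lerD ?sumr_ge0 // ler_sum.
Qed.

(** Used to embed cut pairs and matching edges into the ordered edges of [GX], discarding the other
    nonnegative terms. *)
Lemma sum_inj_le (R : realType) (I J : finType) (phi : I -> J)
    (P : pred I) (Q : pred J) (a : J -> R) :
  injective phi -> (forall i, P i -> Q (phi i)) -> (forall j, Q j -> 0 <= a j) ->
  \sum_(i | P i) a (phi i) <= \sum_(j | Q j) a j.
Proof.
move=> phi_inj PQ a_ge0; rewrite [leRHS](bigID (mem (phi @: P))) /= -[leLHS]addr0.
apply: lerD; last by apply: sumr_ge0 => j /andP[/a_ge0].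
rewrite -(big_imset a (h := phi) (A := P)) /=; last by move=> i j _ _; apply: phi_inj.
rewrite le_eqVlt; apply/orP; left; apply/eqP/eq_bigl => j.
apply/idP/andP => [jP | []//]; split=> //.
by have /imsetP[i /PQ Qi ->] := jP.
Qed.

(** * The value of a solution as an energy *)

Section Energy.

Variables (R : realType) (X : finType) (GX : sgraph X) (len : X -> X -> R) (L : R).
Variable f : X + X -> X.
Hypothesis len_ge0 : forall u v, 0 <= len u v.
Hypothesis L_ge0 : 0 <= L.
Hypothesis fT : integral_solution f.

Local Notation D := (inst_metric GX len L).

Lemma inst_metric_ge0 u v : 0 <= D u v.
Proof.
by rewrite /inst_metric; case: eqP => // _; rewrite addr_ge0 ?mulr_ge0 ?spdist_ge0.
Qed.

Lemma spdist_le_inst_metric u v : spdist GX len u v <= D u v.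
Proof.
rewrite /inst_metric; case: eqP => [-> | _]; first exact: spdist_xx_le0.
by rewrite lerDl mulr_ge0.
Qed.

(** Doubling undoes the halving in [edge_sum]. Terminal edges are kept only in the orientation
    leaving the terminal, which [f] fixes; the opposite one is dropped as nonnegative. *)
Lemma inst_value_split :
  \sum_(p | GX p.1 p.2) D (f (inl p.1)) (f (inl p.2)) / len p.1 p.2
    + \sum_u D u (f (inl u)) / L <= 2 * inst_value GX len L f.
Proof.
rewrite /inst_value /edge_sum mulrC divfK ?pnatr_eq0 // big_sumType /=.
apply: lerD.
  rewrite -(pair_big_dep xpredT GX
    (fun u v => D (f (inl u)) (f (inl v)) / len u v)) /=.
  apply: ler_sum => u _; rewrite big_sumType /= -[leLHS]addr0.
  apply: lerD; first by apply: ler_sum => v _; rewrite mulrC div1r.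
  by apply: sumr_ge0 => v _; rewrite mulr_ge0 ?inst_metric_ge0 // divr_ge0.
apply: ler_sum => u _; rewrite big_sumType /= big_pred0_eq addr0.
by rewrite (big_pred1 u) 1?fT 1?mulrC ?div1r // => v; rewrite eq_sym.
Qed.

End Energy.

(** Turns all real powers of [log n] into integral powers of its cube root, so that exponents become
    ring arithmetic. *)
Lemma powR_third (R : realType) (x : R) (k : nat) :
  x `^ (k%:R / 3) = (x `^ (1 / 3)) ^+ k.
Proof.
by rewrite -powR_mulrn ?powR_ge0 // -powRrM; congr (_ `^ _); rewrite mulrC div1r.
Qed.

(** * Rounding a cheap solution to a split *)

Section Rounding.

Variables (R : realType) (d : nat) (phi gamma eps : R) (n : nat).
Variables (VG VH : finType) (G : sgraph VG) (H : sgraph VH).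
Variables (GX : sgraph (VG * VH)%type) (sg : {ffun VG * VG -> {perm VH}}).
Variable f : (VG * VH) + (VG * VH) -> VG * VH.

Local Notation L := (logR R n).
Local Notation len := (@ell R n VG VH).
Local Notation D := (spdist GX len).
Local Notation dG := (spdist G (fun _ _ => 1 : R)).
Local Notation F u := (f (inl u)).

Hypothesis d_ge3 : (3 <= d)%N.
Hypothesis phi_gt0 : 0 < phi.
Hypothesis eps_gt0 : 0 < eps.
Hypothesis eps_phi : eps <= phi.
Hypothesis eps_gamma : eps <= gamma / 8.
Hypothesis n_gt0 : (0 < n)%N.
Hypothesis L_ge1 : 1 <= L.
Hypothesis L_gamma : 8 <= gamma * L.
Hypothesis cardVG : #|VG| = n.
Hypothesis cardVH : #|VH| = n.
Hypothesis degG : forall g, #|[set g' | G g g']| = d.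
Hypothesis expG : expander phi G.
Hypothesis expH : expander phi H.
Hypothesis girthG : girth_ge (gamma * L) G.
Hypothesis GXE : forall u v, GX u v = ext_rel G H sg u v.
Hypothesis fT : integral_solution f.
Hypothesis f_value : inst_value GX len L f <= 32^-1 * eps ^+ 2 * n%:R ^+ 2 * L `^ (2 / 3).

Local Notation a := (L `^ (1 / 3)).

Lemma L_gt0 : 0 < L. Proof. exact: lt_le_trans L_ge1. Qed.

Lemma a_gt0 : 0 < a. Proof. exact: powR_gt0 L_gt0. Qed.

Lemma L_cube : L = a ^+ 3.
Proof. by rewrite -powR_third divff ?pnatr_eq0 // powRr1 // ltW // L_gt0. Qed.

Lemma a_ge1 : 1 <= a.
Proof. by rewrite -(@expr_ge1 _ 3) -?L_cube ?(ltW a_gt0). Qed.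

Lemma connectG g g' : connect G g g'.
Proof. exact: expander_connect phi_gt0 expG. Qed.

Lemma connectGX u v : connect GX u v.
Proof.
apply: (extension_connect GXE) => *; first exact: connectG.
exact: expander_connect phi_gt0 expH.
Qed.

Let len_ge0 := @ell_ge0 VG VH R n.

Lemma D_ge0 u v : 0 <= D u v.
Proof. exact: spdist_ge0. Qed.

Lemma ell_inter g g' h h' : g != g' -> len (g, h) (g', h') = a ^+ 2.
Proof. by rewrite /ell /= => /negPf->; rewrite powR_third. Qed.

Lemma energy :
  \sum_(p | GX p.1 p.2) inst_metric GX len L (F p.1) (F p.2) / len p.1 p.2
    + \sum_u inst_metric GX len L u (F u) / L
  <= 16^-1 * eps ^+ 2 * n%:R ^+ 2 * a ^+ 2.
Proof.
apply: le_trans (inst_value_split GX len_ge0 (ltW L_gt0) fT) _.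
by move: f_value; rewrite powR_third; lra.
Qed.

Let M_ge0 u v : 0 <= inst_metric GX len L u v.
Proof. exact: inst_metric_ge0 len_ge0 (ltW L_gt0) _ _. Qed.

Definition cut g : {set VH * VH} :=
  [set p : VH * VH | H p.1 p.2 && (F (g, p.1) != F (g, p.2))].

(** Distinct terminals are at distance at least [2 * L] and intra-cloud edges have length [a], so
    each cut pair pays at least [2 * a ^+ 2]. *)
Lemma intra_energy : \sum_g #|cut g|%:R <= 32^-1 * eps ^+ 2 * n%:R ^+ 2.
Proof.
have a0 := a_gt0.
pose M2 p := inst_metric GX len L (F p.1) (F p.2) / len p.1 p.2.
have: \sum_g \sum_(p in cut g) (2 * a ^+ 2) <= \sum_(p | GX p.1 p.2) M2 p.
  rewrite pair_big_dep /=.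
  pose inj (t : VG * (VH * VH)) := ((t.1, t.2.1), (t.1, t.2.2)).
  apply: le_trans (@sum_inj_le R _ _ inj (fun t => t.2 \in cut t.1) _ M2 _ _ _).
  - apply: ler_sum => -[g [h h']]; rewrite inE /= /M2 /inst_metric /= /ell /= eqxx.
    case/andP=> _ /negPf->; rewrite ler_pdivlMr //.
    have -> : 2 * a ^+ 2 * a = 2 * L by rewrite {3}L_cube -mulrA -exprSr.
    by rewrite lerDr D_ge0.
  - by move=> [g [h h']] [g1 [h1 h1']] [-> -> _ ->].
  - by move=> [g [h h']]; rewrite inE /= (intra_edge GXE) => /andP[].
  by move=> p _; rewrite divr_ge0.
have : 0 <= \sum_u inst_metric GX len L u (F u) / L.
  by apply: sumr_ge0 => u _; rewrite divr_ge0 // ltW // L_gt0.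
have := energy; rewrite -/M2.
under [X in _ -> _ -> X <= _ -> _]eq_bigr do rewrite sumr_const -[_ *+ #|_|]mulr_natl.
rewrite -[X in _ -> _ -> X <= _ -> _]mulr_suml => le1 le2 le3.
rewrite -(ler_pM2r (exprn_gt0 2 a0)); lra.
Qed.

(** Matching edges have length [a ^+ 2], which raises the energy bound from [a ^+ 2] to [a ^+ 4]. *)
Lemma inter_energy :
  \sum_(e | G e.1 e.2) \sum_h D (F (e.1, h)) (F (e.2, sg e h))
  <= 16^-1 * eps ^+ 2 * n%:R ^+ 2 * a ^+ 4.
Proof.
have a0 := a_gt0.
pose M2 p := inst_metric GX len L (F p.1) (F p.2) / len p.1 p.2.
have: \sum_(e | G e.1 e.2) \sum_h D (F (e.1, h)) (F (e.2, sg e h)) / a ^+ 2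
      <= \sum_(p | GX p.1 p.2) M2 p.
  rewrite pair_big_dep /=.
  pose inj (t : (VG * VG) * VH) := ((t.1.1, t.2), (t.1.2, sg t.1 t.2)).
  apply: le_trans (@sum_inj_le R _ _ inj (fun t => G t.1.1 t.1.2 && true) _ M2 _ _ _).
  - apply: ler_sum => -[[g g'] h] /= /andP[Gg _]; rewrite /M2 /= ell_inter; last first.
      by apply: contraTneq Gg => ->; rewrite adj_irr.
    rewrite ler_pM2r ?invr_gt0 ?exprn_gt0 //.
    exact: spdist_le_inst_metric len_ge0 (ltW L_gt0) _ _.
  - by move=> [[g g'] h] [[g1 g1'] h1] [-> -> -> _].
  - by move=> [[g g'] h] /= /andP[Gg _]; apply: (inter_edge GXE).
  by move=> p _; rewrite divr_ge0.
have : 0 <= \sum_u inst_metric GX len L u (F u) / L.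
  by apply: sumr_ge0 => u _; rewrite divr_ge0 // ltW // L_gt0.
have := energy; rewrite -/M2.
under [X in _ -> _ -> X <= _ -> _]eq_bigr do rewrite -mulr_suml.
rewrite -[X in _ -> _ -> X <= _ -> _]mulr_suml => le1 le2; rewrite ler_pdivrMr ?exprn_gt0 // => le3.
apply: le_trans le3 _.
have -> : a ^+ 4 = a ^+ 2 * a ^+ 2 by rewrite -exprD.
rewrite [leRHS]mulrA ler_pM2r ?exprn_gt0 //; lra.
Qed.

(** Terminal edges have weight [1 / L], and [a ^+ 2 * L = a ^+ 5]. *)
Lemma terminal_energy :
  \sum_g \sum_h D (g, h) (F (g, h)) <= 16^-1 * eps ^+ 2 * n%:R ^+ 2 * a ^+ 5.
Proof.
have a0 := a_gt0.
have : 0 <= \sum_(p | GX p.1 p.2) inst_metric GX len L (F p.1) (F p.2) / len p.1 p.2.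
  by apply: sumr_ge0 => p _; rewrite divr_ge0.
have := energy; rewrite -mulr_suml => le1 le2.
have le3 : (\sum_u inst_metric GX len L u (F u)) / L
           <= 16^-1 * eps ^+ 2 * n%:R ^+ 2 * a ^+ 2 by lra.
have a5 : a ^+ 2 * L = a ^+ 5 by rewrite {2}L_cube -exprD.
rewrite ler_pdivrMr ?L_gt0 // -[X in _ <= X]mulrA a5 in le3.
apply: le_trans le3; rewrite pair_big /=; apply: ler_sum => -[g h] _.
exact: spdist_le_inst_metric len_ge0 (ltW L_gt0) _ _.
Qed.

(** With three quarters on both sides of a perfect matching, more than half of its edges join
    majority points. *)
Definition supermajority g x := (3 * n < 4 * #|[set h | F (g, h) == x]|)%N.

Lemma supermajority_exists : exists fbar : VG -> VG * VH, forall g,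
  #|cut g|%:R < phi * n%:R / 4 -> supermajority g (fbar g).
Proof.
apply: (@fin_all_exists VG (fun=> (VG * VH)%type)
  (fun g x => #|cut g|%:R < phi * n%:R / 4 -> supermajority g x)) => g.
have VH_gt0 : (0 < #|VH|)%N by rewrite cardVH.
have [le_cut | [h0 maj]] := expander_majority (fun h => F (g, h)) phi_gt0 expH VH_gt0.
  (* A cloud above the cut threshold receives an arbitrary value. *)
  have /card_gt0P[h0 _] := VH_gt0; exists (g, h0) => lt_cut.
  by rewrite cardVH in le_cut; have := lt_le_trans lt_cut le_cut; rewrite ltxx.
by exists (F (g, h0)) => _; rewrite cardVH in maj.
Qed.

Variable fbar : VG -> VG * VH.
Hypothesis fbarP : forall g, #|cut g|%:R < phi * n%:R / 4 -> supermajority g (fbar g).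

(** The threshold is that of [expander_majority]. The next two sets avoid torn clouds, where nothing
    is known of [fbar]. *)
Definition torn : {set VG} := [set g | phi * n%:R / 4 <= #|cut g|%:R].
Definition displaced : {set VG} :=
  [set g | (g \notin torn) && (eps * L < dG g (fbar g).1)].
Definition stretched : {set VG * VG} :=
  [set e | [&& G e.1 e.2, e.1 \notin torn, e.2 \notin torn
             & eps * a ^+ 4 <= D (fbar e.1) (fbar e.2)]].

Let N_gt0 : 0 < n%:R :> R. Proof. by rewrite ltr0n. Qed.

Lemma card_torn : #|torn|%:R <= eps * n%:R / 8.
Proof.
have := markov_card (S := torn) (t := phi * n%:R / 4) (fun g => ler0n R #|cut g|).
move=> /(_ _)/le_trans/(_ intra_energy) le1.
have {}le1 : #|torn|%:R * (phi * n%:R / 4) <= 32^-1 * eps ^+ 2 * n%:R ^+ 2.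
  by apply: le1 => g; rewrite inE.
(* Here [eps <= phi] trades one factor [eps] for [phi]. *)
have le2 : 32^-1 * eps ^+ 2 * n%:R ^+ 2 <= eps * n%:R / 8 * (phi * n%:R / 4).
  have -> : eps * n%:R / 8 * (phi * n%:R / 4) = 32^-1 * eps * phi * n%:R ^+ 2 by field.
  by rewrite ler_pM2r ?exprn_gt0 // expr2 mulrA ler_pM2l // mulr_gt0 ?invr_gt0.
by have := le_trans le1 le2; rewrite ler_pM2r // divr_gt0 // mulr_gt0.
Qed.

Lemma notin_torn g : g \notin torn -> supermajority g (fbar g).
Proof. by rewrite inE -ltNge => /fbarP. Qed.

(** At least [3 / 4 * n] points of a displaced cloud travel further than [eps * L] in [G], at cost
    [a ^+ 2] per step, hence at least [eps * a ^+ 5] each. *)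
Lemma card_displaced : #|displaced|%:R <= eps * n%:R / 12.
Proof.
have a0 := a_gt0.
have leS : #|displaced|%:R * (3 / 4 * n%:R * (eps * a ^+ 5))
    <= \sum_g \sum_h D (g, h) (F (g, h)).
  apply: markov_card => g; first by apply: sumr_ge0 => h _; apply: D_ge0.
  rewrite inE => /andP[/notin_torn plur far].
  apply: le_trans (markov_card (S := [set h | F (g, h) == fbar g])
    (a := fun h => D (g, h) (F (g, h))) (t := eps * a ^+ 5) _ _).
  - rewrite ler_pM2r ?mulr_gt0 ?exprn_gt0 //.
    by move: plur; rewrite /supermajority -(ltr_nat R) !natrM; lra.
  - by move=> h; apply: D_ge0.
  move=> h; rewrite inE => /eqP Fh.
  apply: le_trans (spdist_project GXE R n (connectGX _ _)).
  rewrite Fh powR_third /= (exprD a 2 3) mulrCA -L_cube.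
  by rewrite ler_pM2l ?exprn_gt0 // ltW.
have := le_trans leS terminal_energy.
have -> : 16^-1 * eps ^+ 2 * n%:R ^+ 2 * a ^+ 5
  = eps * n%:R / 12 * (3 / 4 * n%:R * (eps * a ^+ 5)) by field.
by rewrite ler_pM2r // !mulr_gt0 ?invr_gt0 ?exprn_gt0.
Qed.

(** At least half of the matching over a stretched pair joins points sent to the two values of
    [fbar], each paying [eps * a ^+ 4]. *)
Lemma card_stretched : #|stretched|%:R <= eps * n%:R / 8.
Proof.
have a0 := a_gt0.
have leS : #|stretched|%:R * (n%:R / 2 * (eps * a ^+ 4))
    <= \sum_(e | G e.1 e.2) \sum_h D (F (e.1, h)) (F (e.2, sg e h)).
  rewrite big_mkcond; apply: markov_card => e.
    by case: ifP => // _; apply: sumr_ge0 => h _; apply: D_ge0.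
  rewrite inE => /and4P[-> /notin_torn plur1 /notin_torn plur2 far].
  pose S1 := [set h | F (e.1, h) == fbar e.1].
  pose S2 := [set h | F (e.2, sg e h) == fbar e.2].
  apply: le_trans (markov_card (S := S1 :&: S2) (t := eps * a ^+ 4)
    (a := fun h => D (F (e.1, h)) (F (e.2, sg e h))) _ _).
  - rewrite ler_pM2r ?mulr_gt0 ?exprn_gt0 // ler_pdivrMr ?ltr0n // -natrM ler_nat.
    (* The matching is a bijection, so the preimage of the second majority set has the same size. *)
    have cS2 : #|S2| = #|[set h | F (e.2, h) == fbar e.2]|.
      rewrite -[RHS](on_card_preimset (f := sg e)).
        by apply: eq_card => h; rewrite !inE.
      by apply: onW_bij; exists (sg e)^-1%g; [exact: permK | exact: permKV].
    have leU : (#|S1 :|: S2| <= n)%N by rewrite -cardVH max_card.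
    have := cardsUI S1 S2.
    by move: plur1 plur2 leU; rewrite /supermajority -cS2 -/S1; lia.
  - by move=> h; apply: D_ge0.
  by move=> h; rewrite !inE => /andP[/eqP-> /eqP->].
have := le_trans leS inter_energy.
have -> : 16^-1 * eps ^+ 2 * n%:R ^+ 2 * a ^+ 4
  = eps * n%:R / 8 * (n%:R / 2 * (eps * a ^+ 4)) by field.
by rewrite ler_pM2r // !mulr_gt0 ?invr_gt0 ?exprn_gt0.
Qed.

Definition kept_vertices : {set VG} := ~: (torn :|: displaced).

(** Asking for both orientations makes the relation symmetric by construction and bounds the walk of
    an edge whichever way it is listed. *)
Definition kept_rel : rel VG := fun g g' =>
  [&& G g g', g \in kept_vertices, g' \in kept_vertices,
      D (fbar g) (fbar g') < eps * a ^+ 4 & D (fbar g') (fbar g) < eps * a ^+ 4].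

Lemma kept_sym : symmetric kept_rel.
Proof.
by move=> g g'; rewrite /kept_rel adj_sym; apply/and5P/and5P => -[? ? ? ? ?]; split.
Qed.

Lemma kept_irr : irreflexive kept_rel.
Proof. by move=> g; rewrite /kept_rel adj_irr. Qed.

Definition kept : sgraph VG := SGraph kept_sym kept_irr.

(** A lost ordered pair has an endpoint that is torn or displaced, or it or its reverse is
    stretched. Bad endpoints cost at most [5 / 12 * eps * n * d] pairs; stretched pairs cost
    [eps * n / 4], at most [eps * n * d / 12] as [d] is at least 3. The total is half of the
    allowance. *)
Lemma card_kept : (1 - eps) * #|edge_set G|%:R <= #|edge_set kept|%:R.
Proof.
have cG : (#|edge_set G| * 2 = n * d)%N.
  rewrite card_edge_set -cardVG -cardsT -(card_pairs_from _ degG).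
  by apply: eq_card => p; rewrite !inE andbT.
pose B := torn :|: displaced.
pose from_B := [set e : VG * VG | G e.1 e.2 && (e.1 \in B)].
pose to_B := [set e : VG * VG | G e.2 e.1 && (e.2 \in B)].
pose back := [set e : VG * VG | (e.2, e.1) \in stretched].
have c_from : #|from_B| = (#|B| * d)%N by apply: card_pairs_from.
have c_to : #|to_B| = (#|B| * d)%N.
  by rewrite (card_swap_pairs (fun g g' => G g g' && (g \in B))).
have c_back : #|back| = #|stretched|.
  rewrite (card_swap_pairs (fun g g' => (g, g') \in stretched)).
  by apply: eq_card => -[g g']; rewrite inE.
have sub : [set e | G e.1 e.2] \subset
    [set e | kept e.1 e.2] :|: (from_B :|: to_B :|: (stretched :|: back)).
  apply/fintype.subsetP => -[g g']; rewrite inE /= => Gg; apply/finset.setUP.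
  have [gg' | not_kept] := boolP (kept g g'); [by left; rewrite inE | right].
  apply/finset.setUP; have [gB | gNB] := boolP (g \in B).
    by left; apply/finset.setUP; left; rewrite inE Gg.
  have [g'B | g'NB] := boolP (g' \in B).
    by left; apply/finset.setUP; right; rewrite inE /= adj_sym Gg.
  right; have tornB := fintype.subsetP (finset.subsetUl torn displaced).
  have gNt : g \notin torn by apply: contraNN gNB => /tornB.
  have g'Nt : g' \notin torn by apply: contraNN g'NB => /tornB.
  apply/finset.setUP.
  have [lt1 | ge1] := ltP (D (fbar g) (fbar g')) (eps * a ^+ 4).
    have [lt2 | ge2] := ltP (D (fbar g') (fbar g)) (eps * a ^+ 4).
      by case/negP: not_kept; rewrite /= /kept_rel Gg !finset.in_setC gNB g'NB lt1.
    by right; rewrite inE inE /= adj_sym Gg gNt g'Nt.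
  by left; rewrite inE /= Gg gNt g'Nt.
have le_nat : (n * d <= #|edge_set kept| * 2 + (2 * (#|B| * d) + 2 * #|stretched|))%N.
  rewrite -cG !card_edge_set; apply: leq_trans (subset_leq_card sub) _.
  apply: leq_trans (leq_card_setU _ _).1 _; rewrite leq_add2l.
  apply: leq_trans (leq_card_setU _ _).1 _; apply: leq_add.
    by apply: leq_trans (leq_card_setU _ _).1 _; rewrite c_from c_to mul2n addnn.
  by apply: leq_trans (leq_card_setU _ _).1 _; rewrite c_back mul2n addnn.
have leB : #|B|%:R <= #|torn|%:R + #|displaced|%:R :> R.
  by rewrite -natrD ler_nat (leq_card_setU torn displaced).1.
have := card_torn; have := card_displaced; have := card_stretched.
move: le_nat cG; rewrite -(ler_nat R) => le_nat /(congr1 (fun k => k%:R : R)).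
move: le_nat; rewrite !natrD !natrM => le_nat cG cS cD cT.
(* The constant is 1/8 + 1/12, from torn and displaced clouds. *)
have {}cT : #|B|%:R <= eps * n%:R * (5 / 24) by lra.
have d3 : 3 <= d%:R :> R by rewrite ler_nat.
have cTd : #|B|%:R * d%:R <= eps * n%:R * (5 / 24) * d%:R by rewrite ler_wpM2r.
have cSd : eps * n%:R * 3 <= eps * n%:R * d%:R by rewrite ler_wpM2l // mulr_ge0 // ltW.
have : eps * (#|edge_set G|%:R * 2) = eps * (n%:R * d%:R) by rewrite cG.
have : 0 <= eps * (n%:R * d%:R) by rewrite mulr_ge0 ?mulr_ge0 // ltW.
nra.
Qed.

Lemma kept_edge u v : [set u; v] \in edge_set kept ->
  [/\ G u v, u \in kept_vertices, v \in kept_vertices,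
      D (fbar u) (fbar v) < eps * a ^+ 4 & D (fbar v) (fbar u) < eps * a ^+ 4].
Proof. by rewrite edge_setE => /and5P. Qed.

Lemma kept_near g : g \in kept_vertices -> dG g (fbar g).1 <= eps * L.
Proof.
by rewrite !inE negb_or -ltNge => /andP[-> /=]; rewrite leNgt.
Qed.

(** Each projected step costs [a ^+ 2], so there are fewer than [eps * a ^+ 2] of them; the added 1
    counts the starting vertex. *)
Lemma project_short_walk w u v :
  shortest_path GX len w u v -> D u v < eps * a ^+ 4 ->
  is_walk G (project_walk w) u.1 v.1
  /\ (size (project_walk w))%:R < eps * a ^+ 2 + 1.
Proof.
have a0 := a_gt0; case=> GXw lenw ltD.
have [Gw le_w] := project_walkP GXE R n GXw; split=> //; move: Gw le_w.
rewrite lenw powR_third; case: (project_walk w) => [|x p] // _ /= le_p.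
rewrite -natr1 ltrD2r -(ltr_pM2l (exprn_gt0 2 a0)).
by apply: le_lt_trans le_p _; rewrite mulrCA -exprD.
Qed.

Theorem rounding_is_split :
  is_split n G GX len (eps * L `^ (4 / 3)) eps kept_vertices (edge_set kept) fbar.
Proof.
have a0 := a_gt0.
have sub_kept : edge_set kept \subset edge_set G.
  apply/fintype.subsetP => _ /imsetP[[u v] /[!inE] /= /and5P[Guv _ _ _ _] ->].
  by rewrite edge_setE.
have [q qP] : exists q : VG -> seq VG, forall g, g \in kept_vertices ->
    [/\ path G g (q g), last g (q g) = (fbar g).1 & (size (q g))%:R < eps * L + 1].
  apply: (@fin_all_exists VG (fun=> seq VG) (fun g q => g \in kept_vertices ->
    [/\ path G g q, last g q = (fbar g).1 & (size q)%:R < eps * L + 1])) => g.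
  have [kg | ] := boolP (g \in _); last by exists [::].
  (* The added 1 makes the bound strict, as needed to extract a walk from an infimum. *)
  have ltd : dG g (fbar g).1 < eps * L + 1.
    by apply: le_lt_trans (kept_near kg) _; rewrite ltrDl.
  have [[|_ p] //= /and3P[/eqP-> Gp /eqP lp]] := spdist_lt_walk (connectG _ _) ltd.
  by rewrite wlen1; exists p.
split.
- split; last exact: card_kept; split=> // _ /imsetP[[u v] /[!inE] /= /and5P[_ ku kv _ _] ->].
  by apply/fintype.subsetP => x; rewrite finset.in_set2 => /orP[]/eqP->.
- move=> P shortP.
  have walkP u v : [set u; v] \in edge_set kept ->
      (is_walk G (project_walk (P [set u; v])) (fbar u).1 (fbar v).1
       \/ is_walk G (project_walk (P [set u; v])) (fbar v).1 (fbar u).1)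
      /\ (size (project_walk (P [set u; v])))%:R < eps * a ^+ 2 + 1.
    move=> kuv; have [_ _ _ Duv Dvu] := kept_edge kuv.
    by have [/project_short_walk/(_ Duv)[] | /project_short_walk/(_ Dvu)[]] :=
      shortP _ _ kuv; split=> //; [left | right].
  apply: (@cycle_homeomorphism_of_short_walks _ _ _ (gamma * L) _ _ _ q) => //.
  + by move=> u v /walkP[].
  + by move=> u v /kept_edge[_ /qP[]].
  move=> u v kuv; have [_ szP] := walkP u v kuv.
  have [_ /qP[_ _ szu] /qP[_ _ szv] _ _] := kept_edge kuv.
  have le_a : eps * a ^+ 2 <= eps * L.
    by rewrite ler_pM2l // {2}L_cube ler_weXn2l ?a_ge1.
  (* The three sizes are each below [eps * L + 1], so they total less than
     [3 / 8 * (gamma * L) + 3], and [3 <= 3 / 8 * (gamma * L)]. *)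
  have : eps * L <= gamma / 8 * L by rewrite ler_pM2r ?L_gt0.
  by rewrite !natrD; move: L_gamma; lra.
- by move=> u v /kept_edge[_ _ _ Duv _]; rewrite powR_third.
exact: kept_near.
Qed.

End Rounding.

(** * Choice of the constants *)

Theorem theorem5p2 (R : realType) :
  exists c : R, 0 < c /\
  forall (d : nat) (phi gamma : R), (3 <= d)%N -> 0 < phi -> 0 < gamma ->
  exists eps0 : R, 0 < eps0 /\
  forall eps : R, 0 < eps -> eps <= eps0 ->
  exists n0 : nat, forall n : nat, (n0 <= n)%N ->
  forall (VG VH : finType) (G : sgraph VG) (H : sgraph VH),
    #|VG| = n -> #|VH| = n ->
    cayley d G -> cayley d H ->
    expander phi G -> expander phi H ->
    girth_ge (gamma * logR R n) G ->
  forall GX : sgraph (VG * VH)%type, Ext_support G H GX ->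
  forall f : (VG * VH) + (VG * VH) -> VG * VH,
    integral_solution f ->
    inst_value GX (@ell R n VG VH) (logR R n) f
      <= c * eps ^+ 2 * n%:R ^+ 2 * logR R n `^ (2 / 3) ->
  exists (V' : {set VG}) (E' : {set {set VG}}) (fbar : VG -> VG * VH),
    is_split n G GX (@ell R n VG VH) (eps * logR R n `^ (4 / 3)) eps V' E' fbar.
Proof.
exists 32^-1; split=> [|d phi gamma d3 phi_gt0 gamma_gt0]; first by rewrite invr_gt0.
(* The first bound controls the torn clouds, the second keeps the closed walks below the girth. *)
exists (Num.min phi (gamma / 8)); split=> [|eps eps_gt0].
  by rewrite lt_min phi_gt0 divr_gt0.
rewrite le_min => /andP[eps_phi eps_gamma].
(* Beyond this exponential, [log n] is at least 1 and [gamma * log n] at least 8. *)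
pose b := sequences.expR (Num.max 1 (8 / gamma)).
exists (Num.bound b) => n le_n VG VH G H cardVG cardVH cayG cayH expG expH girthG.
move=> GX /Ext_supportP[sg GXE] f fT f_value.
have lt_bn : b < n%:R.
  by apply: lt_le_trans (archi_boundP (ltW (expR_gt0 _))) _; rewrite ler_nat.
have n_gt0 : (0 < n)%N by rewrite -(ltr_nat R) (lt_trans (expR_gt0 _) lt_bn).
have: Num.max 1 (8 / gamma) <= logR R n.
  by rewrite -[leLHS]expRK ler_ln ?posrE ?expR_gt0 ?ltr0n // ltW.
rewrite ge_max ler_pdivrMr // mulrC => /andP[L_ge1 L_gamma].
have degG g := cayley_degree g cayG.
have [fbar fbarP] := supermajority_exists f phi_gt0 n_gt0 cardVH expH.
do 2!eexists; exists fbar.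
exact: (rounding_is_split d3 phi_gt0 eps_gt0 eps_phi eps_gamma n_gt0 L_ge1 L_gamma
  cardVG cardVH degG expG expH girthG GXE fT f_value fbarP).
Qed.
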